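(* Let $a=(-1,1)^\top$, $\Theta=\{\mu\in\mathbb{R}^2:a^\top\mu\ge0\}$, $H=\{\mu\in\mathbb{R}^2:a^\top\mu=0\}$. Let $\mu_0=(m,m)^\top\in H$ and let $X_1,X_2,\ldots$ be i.i.d. random vectors in $\mathbb{R}^2$ with mean $\mu_0$ such that: (i) $\Sigma=\operatorname{Var}(X_i)$ is positive definite; (ii) $\mathbb{E}\|X_i-\mu_0\|^3<\infty$; (iii) for every fixed $M<\infty$, $$\mathbb{P}\big[\mu_0+n^{-1/2}\{h\in\mathbb{R}^2:\|h\|\le M\}\subset\operatorname{int}\operatorname{conv}(X_1,\ldots,X_n)\big]\to1\quad(n\to\infty).$$ Select $$\widehat\mu_\Theta\in\operatorname*{arg\,max}_{\mu\in\Theta}L_n(\mu)\ \text{ on }\mathcal{D}_{\Theta,n},\qquad \widehat\mu_H\in\operatorname*{arg\,max}_{\mu\in H}L_n(\mu)\ \text{ on }\mathcal{D}_{H,n},$$ and set $\widehat\mu_\Theta=\mu_0$, respectively $\widehat\mu_H=\mu_0$, on the corresponding complements. Then, as $n\to\infty$, $$\widehat\mu_\Theta-\mu_0=O_p(n^{-1/2}),\qquad \widehat\mu_H-\mu_0=O_p(n^{-1/2}).$$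
   Context: For $\mu\in\mathbb{R}^2$ the normalized empirical likelihood based on $X_1,\ldots,X_n$ is $$L_n(\mu)=\sup\Big\{\prod_{i=1}^n(np_i):\ p_i\ge0,\ \sum_{i=1}^np_i=1,\ \sum_{i=1}^np_i(X_i-\mu)=0\Big\},$$ where the supremum over the empty set is $0$. For nonempty $A\subset\mathbb{R}^2$, $\mathcal{D}_{A,n}$ denotes the event $\{\sup_{\nu\in A}L_n(\nu)>0\}$. Here $\operatorname{conv}$ is the convex hull, $\operatorname{int}$ the interior, and $O_p(n^{-1/2})$ means that $\sqrt n$ times the quantity is bounded in probability. *)

(* Defs.v *)
From HB Require Import structures.
From mathcomp Require Import all_boot all_order all_algebra.
From mathcomp Require Import all_classical all_reals all_analysis.

Set Implicit Arguments.
Unset Strict Implicit.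
Unset Printing Implicit Defensive.

Import Order.TTheory GRing.Theory Num.Theory.
Import numFieldNormedType.Exports.

Local Open Scope classical_set_scope.
Local Open Scope ring_scope.

(* The library's norm `|v| on matrices is the maximum norm. *)
Definition enorm (R : realType) (v : 'cV[R]_2) : R :=
  Num.sqrt (\sum_(i < 2) v i 0 ^+ 2).

Definition borel2 (R : realType) : set_system 'cV[R]_2 := <<s @open 'cV[R]_2 >>.

Section random_vectors.
Context (R : realType) (d : measure_display) (T : measurableType d).
Context (P : probability T R).

Definition random_vector (Y : T -> 'cV[R]_2) : Prop :=
  forall B, borel2 B -> measurable (Y @^-1` B).

Definition mutually_independent (X : nat -> T -> 'cV[R]_2) : Prop :=
  forall (J : seq nat) (B : nat -> set 'cV[R]_2),
    uniq J -> (forall i, i \in J -> borel2 (B i)) ->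
    P (\bigcap_(i in [set` J]) (X i @^-1` B i)) =
    (\prod_(i <- J) P (X i @^-1` B i))%E.

Definition identically_distributed (X : nat -> T -> 'cV[R]_2) : Prop :=
  forall i j B, borel2 B -> P (X i @^-1` B) = P (X j @^-1` B).

Definition iid (X : nat -> T -> 'cV[R]_2) : Prop :=
  [/\ forall i, random_vector (X i), mutually_independent X
    & identically_distributed X].

(* The equality forces both coordinates to be integrable, because the
   expectation of a nonintegrable measurable function is infinite. *)
Definition has_mean (Y : T -> 'cV[R]_2) (mu : 'cV[R]_2) : Prop :=
  forall j : 'I_2, 'E_P[(fun w => Y w j 0)%R]%E = (mu j 0)%:E.

Definition covmx (Y : T -> 'cV[R]_2) : 'M[R]_2 :=
  \matrix_(j < 2, k < 2)
    fine (covariance P (fun w => Y w j 0) (fun w => Y w k 0)).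

(* Y n = O_p(r n) for positive rates r.  The outer measure mu_ext P makes this
   meaningful without any measurability of Y n; on measurable events it
   coincides with P (measurable_mu_extE). *)
Definition bigO_prob (Y : nat -> T -> 'cV[R]_2) (r : nat -> R) : Prop :=
  forall eps : R, 0 < eps -> exists M : R, \forall n \near \oo,
    (mu_ext P [set w | (M < (r n)^-1 * enorm (Y n w))%R] <= eps%:E)%E.

End random_vectors.

Definition posdefmx (R : realType) (S : 'M[R]_2) : Prop :=
  S^T = S /\ forall v : 'cV[R]_2, v != 0 -> 0 < (v^T *m S *m v) 0 0.

Definition simplex (R : realType) (n : nat) : set ('I_n -> R) :=
  [set p | (forall i, 0 <= p i) /\ \sum_(i < n) p i = 1].

Definition conv_hull (R : realType) (n : nat) (x : 'I_n -> 'cV[R]_2) :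
    set 'cV[R]_2 :=
  [set \sum_(i < n) p i *: x i | p in @simplex R n].

(* [sup] is 0 on the empty set, and the set below is bounded above by 1. *)
Definition EL (R : realType) (n : nat) (x : 'I_n -> 'cV[R]_2)
    (mu : 'cV[R]_2) : R :=
  sup [set \prod_(i < n) (n%:R * p i) |
        p in [set p | simplex p /\ \sum_(i < n) p i *: (x i - mu) = 0]].

Definition argmax_on (R : realType) (f : 'cV[R]_2 -> R) (A : set 'cV[R]_2) :
    set 'cV[R]_2 :=
  [set mu | A mu /\ forall nu, A nu -> f nu <= f mu].

(* The sample of size n is X 0, ..., X n.-1. *)
Definition sample (R : realType) (T : Type) (X : nat -> T -> 'cV[R]_2)
    (n : nat) (w : T) : 'I_n -> 'cV[R]_2 := fun i => X i w.
Arguments sample {R T} X n w.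

Definition ELpos_event (R : realType) (T : Type) (X : nat -> T -> 'cV[R]_2)
    (A : set 'cV[R]_2) (n : nat) : set T :=
  [set w | 0 < sup [set EL (sample X n w) nu | nu in A]].

Definition EL_selection (R : realType) (T : Type) (X : nat -> T -> 'cV[R]_2)
    (A : set 'cV[R]_2) (mu0 : 'cV[R]_2) (muhat : nat -> T -> 'cV[R]_2) : Prop :=
  forall n w, (0 < n)%N ->
    (ELpos_event X A n w -> argmax_on (EL (sample X n w)) A (muhat n w)) /\
    (~ ELpos_event X A n w -> muhat n w = mu0).

Definition avec (R : realType) : 'cV[R]_2 :=
  \col_(i < 2) (if i == 0 then -1 else 1).

Definition Theta (R : realType) : set 'cV[R]_2 :=
  [set mu | 0 <= ((avec R)^T *m mu) 0 0].

Definition Hline (R : realType) : set 'cV[R]_2 :=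
  [set mu | ((avec R)^T *m mu) 0 0 = 0].

(* Main.v *)
(* With z_i = X_i - mu0, two facts give the rate.

   Upper bound: if q_i = n p_i, then log q <= 2 (sqrt q - 1) gives
   prod q_i <= exp (- sum (sqrt q_i - 1)^2).  Hence every admissible p with
   prod (n p_i) >= exp (- C) has sum_i (sqrt q_i - 1)^2 <= C, so that the
   weighted mean sum_i p_i z_i is within (2 C + 1) (sum |z_i|^2)^(1/2) / n, that
   is O_p(n^(-1/2)), of the sample mean.

   Lower bound: L_n(mu0) is bounded away from 0.  Take weights proportional to
   1 + u_i with u_i = t . z_i / (1 + |z_i|^2), where t solves S_n t = - zbar for
   the damped scatter matrix S_n = n^(-1) sum z_i z_i^T / (1 + |z_i|^2).  By the
   weak law S_n is close to S = E[z z^T / (1 + |z|^2)], which is positive definite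
   because Sigma is; so t, and with it max |u_i|, is O_p(n^(-1/2)), and
   L_n(mu0) >= exp (- 2 n max u_i^2).

   A maximizer over a set containing mu0 has at least the likelihood of mu0, so
   the upper bound applies to it. *)
Require Import Defs.
From HB Require Import structures.
From mathcomp Require Import all_boot all_order all_algebra.
From mathcomp Require Import ring lra.
From mathcomp Require Import all_classical all_reals all_analysis.
From mathcomp Require Import measurable_realfun.

Set Implicit Arguments.
Unset Strict Implicit.
Unset Printing Implicit Defensive.

Import Order.TTheory GRing.Theory Num.Theory.
Import numFieldNormedType.Exports.

Local Open Scope classical_set_scope.
Local Open Scope ring_scope.

(** * Bounds on the empirical likelihood *)

Section empirical_likelihood.
Context {R : realType}.

(** By [1 + x <= expR x], it suffices that (1 - u + 2 u^2)(1 + u) = 1 + u^2 (1 + 2 u) is at least 1,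
    which is where u >= -1/2 enters. *)
Lemma expR_sub_le1D (u : R) : - 2^-1 <= u -> expR (u - 2 * u ^+ 2) <= 1 + u.
Proof.
move=> hu.
have u1 : 0 < 1 + u by lra.
have h : (1 + u)^-1 <= expR (- (u - 2 * u ^+ 2)).
  apply: le_trans (expR_ge1Dx _).
  rewrite -(ler_pM2r u1) mulVf ?gt_eqF//.
  have : 0 <= u ^+ 2 * (1 + 2 * u) by rewrite mulr_ge0 ?sqr_ge0//; lra.
  by rewrite -subr_ge0; congr (0 <= _); ring.
by move: h; rewrite expRN lef_pV2// ?posrE// expR_gt0.
Qed.

(** With s_i = sqrt(n p_i), the s_i^2 - 1 sum to zero, so - sum (s_i - 1)^2 = sum 2 (s_i - 1). Then
    s_i <= exp(s_i - 1) is squared factor by factor. *)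
Lemma prod_weights_le (n : nat) (p : 'I_n -> R) : (0 < n)%N -> simplex p ->
  \prod_(i < n) (n%:R * p i) <=
  expR (- \sum_(i < n) (Num.sqrt (n%:R * p i) - 1) ^+ 2).
Proof.
move=> n0 [p0 p1].
pose s i := Num.sqrt (n%:R * p i).
have sE i : n%:R * p i = s i ^+ 2 by rewrite sqr_sqrtr// mulr_ge0.
have -> : - \sum_(i < n) (s i - 1) ^+ 2 = \sum_(i < n) 2 * (s i - 1).
  have h : \sum_(i < n) (s i ^+ 2 - 1) = 0.
    under eq_bigr do rewrite -sE.
    by rewrite sumrB -mulr_sumr p1 mulr1 sumr_const card_ord subrr.
  apply/eqP; rewrite -subr_eq0 -opprD oppr_eq0 -big_split/=.
  by apply/eqP; rewrite -[RHS]h; apply: eq_bigr => i _; ring.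
rewrite expR_sum; apply: ler_prod => i _; rewrite mulr_ge0//= sE mulrC expRM_natr.
rewrite lerXn2r ?nnegrE ?sqrtr_ge0 ?expR_ge0//.
by have := expR_ge1Dx (s i - 1); rewrite addrCA subrr addr0.
Qed.

Lemma prod_weights_le1 (n : nat) (p : 'I_n -> R) : (0 < n)%N -> simplex p ->
  \prod_(i < n) (n%:R * p i) <= 1.
Proof.
move=> n0 ps; apply: le_trans (prod_weights_le n0 ps) _.
by rewrite -expR0 ler_expR oppr_le0 sumr_ge0// => i _; rewrite sqr_ge0.
Qed.

(** A likelihood of at least exp(-C) puts the weights within Hellinger-type distance C of the
    uniform ones. The difference of the means is n^(-1) sum (s_i^2 - 1) z_i, and s^2 - 1 = (s - 1)^2
    + 2 (s - 1) splits it into two controllable parts. *)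
Lemma weighted_mean_dist (n : nat) (p z : 'I_n -> R) (C r : R) :
    (0 < n)%N -> simplex p -> 0 < r -> \sum_(i < n) z i ^+ 2 <= r ^+ 2 ->
    expR (- C) <= \prod_(i < n) (n%:R * p i) ->
  `|\sum_(i < n) p i * z i - n%:R^-1 * \sum_(i < n) z i| <=
  n%:R^-1 * ((2 * C + 1) * r).
Proof.
move=> n0 ps r0 zr hC.
have n0' : 0 < n%:R :> R by rewrite ltr0n.
have [p0 p1] := ps.
pose s i := Num.sqrt (n%:R * p i).
have DC : \sum_(i < n) (s i - 1) ^+ 2 <= C.
  by rewrite -lerN2 -ler_expR; exact: le_trans hC (prod_weights_le n0 ps).
have sE i : n%:R * p i = s i ^+ 2 by rewrite sqr_sqrtr// mulr_ge0// ltW.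
have -> : \sum_(i < n) p i * z i - n%:R^-1 * \sum_(i < n) z i
    = n%:R^-1 * \sum_(i < n) (s i ^+ 2 - 1) * z i.
  rewrite !mulr_sumr -sumrB; apply: eq_bigr => i _; rewrite -sE.
  by field; rewrite gt_eqF.
rewrite normrM gtr0_norm ?invr_gt0// ler_pM2l ?invr_gt0//.
apply: le_trans (ler_norm_sum _ _ _) _.
have zi i : `|z i| <= r.
  rewrite -(ger0_norm (ltW r0)) -ler_sqr ?nnegrE ?normr_ge0// !real_normK ?num_real//.
  apply: le_trans zr; rewrite (bigD1 i)//= lerDl sumr_ge0// => j _.
  by rewrite sqr_ge0.
(* Both [h1] and [h2] below contribute r (s_i - 1)^2, hence 2 r C in total; the remaining r comes
   from the terms z_i^2 / r. *)
have -> : (2 * C + 1) * r = 2 * r * C + r^-1 * r ^+ 2 by field; rewrite gt_eqF.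
apply: (@le_trans _ _ (\sum_(i < n) (2 * r * (s i - 1) ^+ 2 + r^-1 * z i ^+ 2))).
  apply: ler_sum => i _.
  have -> : s i ^+ 2 - 1 = (s i - 1) ^+ 2 + 2 * (s i - 1) by ring.
  have h0 : `|((s i - 1) ^+ 2 + 2 * (s i - 1)) * z i| <=
      (s i - 1) ^+ 2 * `|z i| + 2 * `|s i - 1| * `|z i|.
    rewrite mulrDl (le_trans (ler_normD _ _))// (normrM (_ ^+ 2)).
    by rewrite (ger0_norm (sqr_ge0 _)) normrM (normrM 2) (ger0_norm (ler0n _ 2)).
  have h1 : (s i - 1) ^+ 2 * `|z i| <= (s i - 1) ^+ 2 * r.
    by rewrite ler_wpM2l ?sqr_ge0.
  (* AM-GM: [2 |s - 1| |z| <= r (s - 1)^2 + z^2 / r] *)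
  have h2 : 2 * `|s i - 1| * `|z i| <= r * (s i - 1) ^+ 2 + r^-1 * z i ^+ 2.
    rewrite -subr_ge0 -(real_normK (num_real (s i - 1))).
    rewrite -(real_normK (num_real (z i))).
    set a := `|s i - 1|; set b := `|z i|.
    have -> : r * a ^+ 2 + r^-1 * b ^+ 2 - 2 * a * b = r^-1 * (r * a - b) ^+ 2.
      by field; rewrite gt_eqF.
    by rewrite mulr_ge0 ?sqr_ge0 ?invr_ge0 ?(ltW r0).
  by apply: le_trans h0 _; apply: le_trans (lerD h1 h2) _; lra.
rewrite big_split/= -!mulr_sumr lerD// ler_wpM2l//.
- by rewrite mulr_ge0// ltW.
- by rewrite invr_ge0 ltW.
Qed.

Lemma EL_has_ubound (n : nat) (x : 'I_n -> 'cV[R]_2) (mu : 'cV[R]_2) :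
  (0 < n)%N -> ubound [set \prod_(i < n) (n%:R * p i) |
        p in [set p | simplex p /\ \sum_(i < n) p i *: (x i - mu) = 0]] 1.
Proof. by move=> n0 _ [p [ps _] <-]; exact: prod_weights_le1. Qed.

Lemma prod_weights_le_EL (n : nat) (x : 'I_n -> 'cV[R]_2) (mu : 'cV[R]_2)
    (p : 'I_n -> R) :
  (0 < n)%N -> simplex p -> \sum_(i < n) p i *: (x i - mu) = 0 ->
  \prod_(i < n) (n%:R * p i) <= EL x mu.
Proof.
move=> n0 ps pmu; apply: sup_upper_bound; last by exists p.
split; first by exists (\prod_(i < n) (n%:R * p i)); exists p.
by exists 1; exact: EL_has_ubound.
Qed.

(** Near-optimal weights replace attainment of the supremum. Since [sup] is 0 on the empty set,
    [0 <= k] forces admissible weights to exist. *)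
Lemma lt_EL_weights (n : nat) (x : 'I_n -> 'cV[R]_2) (mu : 'cV[R]_2) (k : R) :
  (0 < n)%N -> 0 <= k < EL x mu ->
  exists p, [/\ simplex p, \sum_(i < n) p i *: (x i - mu) = 0
    & k < \prod_(i < n) (n%:R * p i)].
Proof.
move=> n0 /andP[k0].
rewrite /EL; set S := (X in sup X) => kL.
have [S0|/set0P S0] := eqVneq S set0.
  by move: kL; rewrite S0 sup0 ltNge k0.
have [_ [p [ps pmu] <-] kp] := sup_gt S0 kL.
by exists p.
Qed.

Lemma EL_le1 (n : nat) (x : 'I_n -> 'cV[R]_2) (mu : 'cV[R]_2) :
  (0 < n)%N -> EL x mu <= 1.
Proof.
move=> n0; rewrite leNgt; apply/negP => h.
have [|p [ps _]] := @lt_EL_weights n x mu 1 n0; first by rewrite h ler01.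
by rewrite ltNge prod_weights_le1.
Qed.

(** The weights 1 + u_i, normalized by their sum, are admissible. In the logarithm of their
    likelihood the linear terms in u cancel against the normalization, which leaves a loss of at
    most 2 sum u_i^2. *)
Lemma EL_ge (n : nat) (x : 'I_n -> 'cV[R]_2) (mu : 'cV[R]_2) (u : 'I_n -> R)
    (tau : R) : (0 < n)%N ->
    tau <= 2^-1 -> (forall i, `|u i| <= tau) ->
    \sum_(i < n) (1 + u i) *: (x i - mu) = 0 ->
  expR (- (2 * (n%:R * tau ^+ 2))) <= EL x mu.
Proof.
move=> n0 tau2 utau umu.
have n0' : 0 < n%:R :> R by rewrite ltr0n.
have u2 i : - 2^-1 <= u i.
  by have := utau i; rewrite ler_norml => /andP[+ _]; lra.
have q0 i : 0 < 1 + u i by have := u2 i; lra.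
pose Q := \sum_(i < n) (1 + u i).
have Q0 : 0 < Q.
  by rewrite /Q; case: n n0 {x n0' umu} u utau u2 q0 @Q => // n _ u _ _ q0;
  rewrite big_ord_recl ltr_pwDl// sumr_ge0// => i _; rewrite ltW.
pose p i := (1 + u i) / Q.
have ps : simplex p.
  split=> [i|]; first by rewrite divr_ge0 ?ltW.
  by rewrite -mulr_suml mulfV// gt_eqF.
apply: le_trans (prod_weights_le_EL n0 ps _); last first.
  under eq_bigr do rewrite /p mulrC -scalerA.
  by rewrite -scaler_sumr umu scaler0.
pose ubar := \sum_(i < n) u i.
(* [ubar] is the sum of the u_i, so n^(-1) [ubar] is their mean. *)
have QE : Q = n%:R * (1 + n%:R^-1 * ubar).
  rewrite /Q big_split/= sumr_const card_ord -/ubar.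
  by field; rewrite gt_eqF.
have b0 : 0 < 1 + n%:R^-1 * ubar by rewrite -(pmulr_rgt0 _ n0') -QE.
have pE i : n%:R * p i = (1 + u i) * (1 + n%:R^-1 * ubar)^-1.
  by rewrite /p QE invfM mulrCA mulVKf ?gt_eqF.
(* Each numerator 1 + u_i is bounded below by [expR_sub_le1D], and the denominator above by the
   exponential of the mean of u. *)
apply: (@le_trans _ _ (\prod_(i < n)
   (expR (u i - 2 * u i ^+ 2) * expR (- (n%:R^-1 * ubar))))).
  rewrite -(eq_bigr _ (fun i _ => expRD _ _)) -expR_sum ler_expR.
  rewrite big_split/= sumr_const card_ord -[X in _ <= _ + X]mulr_natl mulrN mulVKf ?gt_eqF//.
  rewrite sumrB -/ubar addrAC subrr add0r lerN2 -mulr_sumr ler_pM2l//.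
  rewrite mulr_natl -[X in _ *+ X]card_ord -sumr_const ler_sum// => i _.
  rewrite -(real_normK (num_real (u i))) lerXn2r ?nnegrE ?normr_ge0//.
  by apply: le_trans (utau i); exact: normr_ge0.
apply: ler_prod => i _; rewrite mulr_ge0 ?expR_ge0//= pE.
rewrite ler_pM ?expR_ge0//; first exact: expR_sub_le1D.
by rewrite expRN lef_pV2 ?posrE ?expR_gt0// expR_ge1Dx.
Qed.

End empirical_likelihood.

(** * Deterministic bounds on a well-behaved sample *)

Section good_sample.
Context {R : realType}.

Definition sqnorm (v : 'cV[R]_2) : R := \sum_(j < 2) v j 0 ^+ 2.

(* The factor [1 / (1 + |v|^2)] bounds the entries: their variances are finite
   and the tilted weights are close to 1 without any truncation level. *)
Definition damped (j k : 'I_2) (v : 'cV[R]_2) : R :=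
  v j 0 * v k 0 / (1 + sqnorm v).

Lemma sqnorm_ge0 (v : 'cV[R]_2) : 0 <= sqnorm v.
Proof. by apply: sumr_ge0 => j _; rewrite sqr_ge0. Qed.

Lemma sqr_coord_le_sqnorm (v : 'cV[R]_2) (j : 'I_2) : v j 0 ^+ 2 <= sqnorm v.
Proof.
by rewrite /sqnorm (bigD1 j)//= lerDl sumr_ge0// => i _; rewrite sqr_ge0.
Qed.

Lemma sqnorm1_gt0 (v : 'cV[R]_2) : 0 < 1 + sqnorm v.
Proof. by rewrite ltr_pwDl// sqnorm_ge0. Qed.

Lemma normr_damped_le1 (j k : 'I_2) (v : 'cV[R]_2) : `|damped j k v| <= 1.
Proof.
rewrite /damped normrM normfV (gtr0_norm (sqnorm1_gt0 v)).
rewrite ler_pdivrMr ?sqnorm1_gt0// mul1r normrM.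
have := sqr_coord_le_sqnorm v j; have := sqr_coord_le_sqnorm v k.
rewrite -(real_normK (num_real (v j 0))) -(real_normK (num_real (v k 0))).
by have := sqr_ge0 (`|v j 0| - `|v k 0|); rewrite sqrrB; lra.
Qed.

Lemma normr_coord_le (v : 'cV[R]_2) (j : 'I_2) : `|v j 0| <= 1 + sqnorm v.
Proof.
have := sqr_coord_le_sqnorm v j; have := sqnorm_ge0 v.
rewrite -(real_normK (num_real (v j 0))).
by have := sqr_ge0 (`|v j 0| - 1); rewrite sqrrB; lra.
Qed.

Lemma normr_average_le1 (n : nat) (f : 'I_n -> R) : (0 < n)%N ->
  (forall i, `|f i| <= 1) -> `|n%:R^-1 * \sum_(i < n) f i| <= 1.
Proof.
move=> n0 f1; have n0' : 0 < n%:R :> R by rewrite ltr0n.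
rewrite normrM gtr0_norm ?invr_gt0// ler_pdivrMl// mulr1.
apply: le_trans (ler_norm_sum _ _ _) _.
rewrite -[leRHS]mulr1 mulr_natl -[X in _ *+ X]card_ord -sumr_const.
by apply: ler_sum => i _; exact: f1.
Qed.

(** The change of the determinant telescopes into four products of a perturbation, at most e, and an
    entry, at most 1. The choice of e makes 4 e half of the original determinant. *)
Lemma det2_perturb (a b c a0 b0 c0 : R) :
  `|a| <= 1 -> `|b| <= 1 -> `|c| <= 1 ->
  `|a0| <= 1 -> `|b0| <= 1 -> `|c0| <= 1 ->
  let e := (a0 * c0 - b0 ^+ 2) / 8 in
  `|a - a0| <= e -> `|b - b0| <= e -> `|c - c0| <= e ->
  (a0 * c0 - b0 ^+ 2) / 2 <= a * c - b ^+ 2.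
Proof.
move=> a1 b1 c1 a01 b01 c01 e ae be ce.
have prod_le u v : `|u| <= e -> `|v| <= 1 -> `|u * v| <= e.
  move=> ue v1; rewrite normrM -[leRHS]mulr1 ler_pM//.
have : `|(a - a0) * c + (c - c0) * a0 - (b - b0) * b - (b - b0) * b0| <=
    e + e + e + e.
  apply: le_trans (ler_normB _ _) _; apply: lerD; last exact: prod_le.
  apply: le_trans (ler_normB _ _) _; apply: lerD; last exact: prod_le.
  by apply: le_trans (ler_normD _ _) _; apply: lerD; exact: prod_le.
rewrite ler_norml => /andP[+ _].
have -> : (a - a0) * c + (c - c0) * a0 - (b - b0) * b - (b - b0) * b0 =
  (a * c - b ^+ 2) - (a0 * c0 - b0 ^+ 2) by ring.
by rewrite /e; lra.
Qed.

(** The tilt u_i = t . z_i / (1 + |z_i|^2) gives sum (1 + u_i) z_i = n (zbar + S t), which vanishes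
    when S t = - zbar. The damping keeps |u_i| below 4 rho / delta whatever the size of z_i, so
    [EL_ge] applies. *)
Lemma EL_center_ge (n : nat) (x : 'I_n -> 'cV[R]_2) (mu : 'cV[R]_2)
    (rho delta : R) :
    let z i := x i - mu in
    let S j k := n%:R^-1 * \sum_(i < n) damped j k (z i) in
    (0 < n)%N -> 0 < delta -> delta <= S 0 0 * S 1 1 - S 0 1 ^+ 2 ->
    (forall j, `|n%:R^-1 * \sum_(i < n) z i j 0| <= rho) ->
    4 * rho / delta <= 2^-1 ->
  expR (- (2 * (n%:R * (4 * rho / delta) ^+ 2))) <= EL x mu.
Proof.
move=> z S n0 d0 dS zrho tau2.
set zb := fun j : 'I_2 => n%:R^-1 * \sum_(i < n) z i j 0 in zrho.
set D := S 0 0 * S 1 1 - S 0 1 ^+ 2 in dS.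
have D0 : 0 < D by exact: lt_le_trans dS.
have n0' : 0 < n%:R :> R by rewrite ltr0n.
have S1 j k : `|S j k| <= 1.
  by apply: normr_average_le1 => // i; exact: normr_damped_le1.
(* Cramer's rule for the symmetric system [S t = - zb] *)
pose t0 := (S 0 1 * zb 1 - S 1 1 * zb 0) / D.
pose t1 := (S 0 1 * zb 0 - S 0 0 * zb 1) / D.
(* The entries of S are at most 1, so a Cramer numerator is at most 2 rho; the determinant is at
   least delta. *)
have t_le (a b : R) (j k : 'I_2) : `|a| <= 1 -> `|b| <= 1 ->
    `|(a * zb j - b * zb k) / D| <= 2 * rho / delta.
  move=> a1 b1; rewrite normrM normfV (gtr0_norm D0) ler_pM ?invr_ge0//.
  - by rewrite ltW.
  - rewrite (le_trans (ler_normB _ _))// (normrM a) (normrM b).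
    have -> : 2 * rho = 1 * rho + 1 * rho by ring.
    by apply: lerD; apply: ler_pM => //; exact: zrho.
  - by rewrite lef_pV2.
have t0_le : `|t0| <= 2 * rho / delta by exact: t_le.
have t1_le : `|t1| <= 2 * rho / delta by exact: t_le.
pose u i := (t0 * z i 0 0 + t1 * z i 1 0) / (1 + sqnorm (z i)).
apply: (@EL_ge _ _ _ _ u) => // [i|].
  rewrite /u normrM normfV (gtr0_norm (sqnorm1_gt0 _)).
  rewrite ler_pdivrMr ?sqnorm1_gt0// (le_trans (ler_normD _ _))//.
  rewrite (normrM t0) (normrM t1).
  have -> : 4 * rho / delta * (1 + sqnorm (z i)) =
    2 * rho / delta * (1 + sqnorm (z i)) + 2 * rho / delta * (1 + sqnorm (z i)).
    by field; rewrite gt_eqF.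
  by apply: lerD; apply: ler_pM => //; exact: normr_coord_le.
have zbE j : n%:R * zb j = \sum_(i < n) z i j 0.
  by rewrite /zb mulVKf ?gt_eqF.
have SE j k : n%:R * S j k = \sum_(i < n) damped j k (z i).
  by rewrite /S mulVKf ?gt_eqF.
have sumE (j : 'I_2) : \sum_(i < n) (1 + u i) * z i j 0 =
    n%:R * (zb j + t0 * S 0 j + t1 * S 1 j).
  rewrite !mulrDr zbE (mulrCA _ t0) SE (mulrCA _ t1) SE !mulr_sumr -!big_split/=.
  apply: eq_bigr => i _; rewrite /u /damped.
  by field; rewrite gt_eqF// sqnorm1_gt0.
have S10 : S 1 0 = S 0 1.
  by rewrite /S; congr (_ * _); apply: eq_bigr => i _; rewrite /damped (mulrC (z i 1 0)).
have z0 j : zb j + t0 * S 0 j + t1 * S 1 j = 0.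
  have [->|->] : j = 0 \/ j = 1.
  - by case: j => [[|[|//]] ?]; [left|right]; exact: val_inj.
  - by rewrite S10 /t0 /t1 /D; field; rewrite gt_eqF.
  - by rewrite /t0 /t1 /D; field; rewrite gt_eqF.
apply/colP => j; rewrite summxE [RHS]mxE.
transitivity (\sum_(i < n) (1 + u i) * z i j 0); last by rewrite sumE z0 mulr0.
by apply: eq_bigr => i _; rewrite !mxE.
Qed.

Lemma enorm_le_coord (v : 'cV[R]_2) (c : R) :
  (forall j, `|v j 0| <= c) -> enorm v <= 2 * c.
Proof.
move=> vc; have c0 : 0 <= c by apply: le_trans (vc 0).
rewrite -[leRHS]ger0_norm ?mulr_ge0// -sqrtr_sqr /enorm ler_wsqrtr//.
apply: (@le_trans _ _ (\sum_(j < 2) c ^+ 2)).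
  apply: ler_sum => j _; rewrite -(real_normK (num_real _)).
  by rewrite lerXn2r ?nnegrE.
by rewrite sumr_const card_ord exprMn; have := sqr_ge0 c; lra.
Qed.

(** On a sample with nondegenerate damped scatter, mean of order n^(-1/2) and bounded second moment,
    the likelihood at mu0 is at least exp(-C) with C free of n. A maximizer inherits this bound, and
    its weights are then nearly uniform. *)
Lemma argmax_EL_dist (n : nat) (x : 'I_n -> 'cV[R]_2) (A : set 'cV[R]_2)
    (mu0 mu : 'cV[R]_2) (c1 c2 delta : R) :
    let z i := x i - mu0 in
    let S j k := n%:R^-1 * \sum_(i < n) damped j k (z i) in
    (0 < n)%N -> 0 < delta -> 0 < c2 ->
    delta <= S 0 0 * S 1 1 - S 0 1 ^+ 2 ->
    (forall j, `|n%:R^-1 * \sum_(i < n) z i j 0| <= c1 / Num.sqrt n%:R) ->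
    n%:R^-1 * \sum_(i < n) sqnorm (z i) <= c2 ^+ 2 ->
    4 * (c1 / Num.sqrt n%:R) / delta <= 2^-1 ->
    A mu0 -> (0 < sup [set EL x nu | nu in A] -> argmax_on (EL x) A mu) ->
  Num.sqrt n%:R * enorm (mu - mu0) <=
  2 * (c1 + (2 * (2 * (4 * c1 / delta) ^+ 2 + 1) + 1) * c2).
Proof.
move=> z S n0 d0 c20 dS zb zz tau2 Amu0 sel.
have n0' : 0 < n%:R :> R by rewrite ltr0n.
have sn0 : 0 < Num.sqrt n%:R :> R by rewrite sqrtr_gt0.
have nE : n%:R = Num.sqrt n%:R ^+ 2 :> R by rewrite sqr_sqrtr// ltW.
set C := 2 * _ ^+ 2.
have ELmu0 : expR (- C) <= EL x mu0.
  apply: le_trans (EL_center_ge n0 d0 dS zb tau2).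
  rewrite ler_expR lerN2 le_eqVlt; apply/orP; left; apply/eqP.
  rewrite /C; move: (Num.sqrt n%:R) sn0 nE => sn sn0' ->.
  by field; rewrite !gt_eqF.
have ELbound : has_sup [set EL x nu | nu in A].
  split; first by exists (EL x mu0), mu0.
  by exists 1 => _ [nu _ <-]; exact: EL_le1.
(* Positivity of the likelihood at mu0 places the sample in the event where the selection is a true
   maximizer. *)
have [_ mumax] : argmax_on (EL x) A mu.
  apply: sel; apply: (@lt_le_trans _ _ (EL x mu0)).
    by apply: lt_le_trans ELmu0; exact: expR_gt0.
  by apply: sup_upper_bound => //; exists mu0.
(* The exponent C + 1 instead of C gives the strict inequality needed to extract weights from the
   supremum. *)
have [|p [ps pmu pC]] := @lt_EL_weights _ n x mu (expR (- (C + 1))) n0.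
  rewrite expR_ge0/=; apply: lt_le_trans (mumax _ Amu0).
  by apply: lt_le_trans ELmu0; rewrite ltr_expR; lra.
(* The weighted mean of the x_i is mu and the weights sum to 1, so mu - mu0 is the weighted mean of
   the z_i. *)
have muE j : (mu - mu0) j 0 = \sum_(i < n) p i * z i j 0.
  have [_ p1] := ps.
  have h : \sum_(i < n) p i * (x i j 0 - mu j 0) = 0.
    have := congr1 (fun M : 'cV[R]_2 => M j 0) pmu; rewrite summxE [RHS]mxE.
    by apply: etrans; apply: eq_bigr => i _; rewrite !mxE.
  have -> : \sum_(i < n) p i * z i j 0 = \sum_(i < n) p i * (x i j 0 - mu j 0) +
      \sum_(i < n) p i * (mu j 0 - mu0 j 0).
    by rewrite -big_split/=; apply: eq_bigr => i _; rewrite /z !mxE; ring.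
  by rewrite h add0r -mulr_suml p1 mul1r !mxE.
rewrite mulrC -ler_pdivlMr// -mulrA; apply: enorm_le_coord => j.
rewrite muE.
(* The radius c2 sqrt(n) fits since sum |z_i|^2 <= n c2^2; divided by n it yields the rate
   n^(-1/2). *)
have := @weighted_mean_dist _ n p (fun i => z i j 0) (C + 1)
  (c2 * Num.sqrt n%:R) n0 ps.
rewrite mulr_gt0// => /(_ isT).
have -> : \sum_(i < n) z i j 0 ^+ 2 <= (c2 * Num.sqrt n%:R) ^+ 2.
  rewrite exprMn -nE -ler_pdivrMr// mulrC; apply: le_trans zz.
  apply: ler_wpM2l; first by rewrite invr_ge0 ltW.
  apply: ler_sum => i _.
  exact: sqr_coord_le_sqnorm.
move=> /(_ isT (ltW pC)) dist.
set zbj := n%:R^-1 * _ in dist.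
have -> : \sum_(i < n) p i * z i j 0 =
  zbj + (\sum_(i < n) p i * z i j 0 - zbj) by ring.
apply: le_trans (ler_normD _ _) _; apply: le_trans (lerD (zb j) dist) _.
rewrite le_eqVlt; apply/orP; left; apply/eqP.
move: (Num.sqrt n%:R) sn0 nE => sn sn0' ->.
by field; rewrite !gt_eqF.
Qed.

End good_sample.

(** * Pairwise independence and Chebyshev's inequality *)

Section probability_preliminaries.
Context {R : realType} {d : measure_display} {T : measurableType d}.
Variable P : probability T R.

Local Notation integrable f := (P.-integrable [set: T] (EFin \o f)).

Lemma le_integrable_real (f g : T -> R) : measurable_fun [set: T] f ->
  (forall w, `|f w| <= g w) -> integrable g -> integrable f.
Proof.
move=> mf fg ig; apply: le_integrable ig => //; first exact/measurable_EFinP.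
by move=> w _ /=; rewrite lee_fin (le_trans (fg w))// ler_norm.
Qed.

Lemma integrable_cst_real (c : R) : integrable (fun=> c).
Proof.
apply: measurable_bounded_integrable => //.
- by rewrite (@le_lt_trans _ _ 1%E) ?probability_le1// ltry.
- by exists `|c|; split; [exact: num_real|move=> M /ltW cM w _].
Qed.

Lemma integrableD_real (f g : T -> R) : integrable f -> integrable g ->
  integrable (fun w => f w + g w).
Proof. by move=> fi gi; exact: (integrableD measurableT fi gi). Qed.

Lemma integrable_of_sqr (f : T -> R) : measurable_fun [set: T] f ->
  integrable (fun w => f w ^+ 2) -> integrable f.
Proof.
move=> mf if2; apply: (@le_integrable_real _ (fun w => 1 + f w ^+ 2)) => //.
  move=> w; rewrite -(real_normK (num_real (f w))).
  by have := sqr_ge0 (`|f w| - 1); have := sqr_ge0 `|f w|; rewrite sqrrB; lra.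
by apply: integrableD_real => //; exact: integrable_cst_real.
Qed.

Lemma integrable_mul_of_sqr (f g : T -> R) :
  measurable_fun [set: T] f -> measurable_fun [set: T] g ->
  integrable (fun w => f w ^+ 2) -> integrable (fun w => g w ^+ 2) ->
  integrable (fun w => f w * g w).
Proof.
move=> mf mg if2 ig2.
apply: (@le_integrable_real _ (fun w => f w ^+ 2 + g w ^+ 2)).
- exact: measurable_funM.
- move=> w; rewrite normrM -(real_normK (num_real (f w))).
  rewrite -(real_normK (num_real (g w))).
  have := sqr_ge0 (`|f w| - `|g w|); have := sqr_ge0 `|f w|.
  by have := sqr_ge0 `|g w|; rewrite sqrrB; lra.
- exact: integrableD_real.
Qed.

Lemma integrable_sum_real (I : Type) (s : seq I) (f : I -> T -> R) :
  (forall i, integrable (f i)) -> integrable (fun w => \sum_(i <- s) f i w).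
Proof.
move=> fi; have := @integrable_sum _ _ _ P _ measurableT _ s xpredT
  (fun i => EFin \o f i) (fun i _ => fi i).
by apply: eq_integrable => // w _; rewrite /= sumEFin.
Qed.

Lemma Rintegral_sum (I : Type) (s : seq I) (f : I -> T -> R) :
  (forall i, integrable (f i)) ->
  \int[P]_w (\sum_(i <- s) f i w) = \sum_(i <- s) \int[P]_w f i w.
Proof.
move=> fi; elim: s => [|i s ih].
  rewrite big_nil; under eq_Rintegral do rewrite big_nil.
  by rewrite Rintegral_cst// mul0r.
rewrite big_cons -ih -RintegralD//; last exact: integrable_sum_real.
by apply: eq_Rintegral => w _; rewrite big_cons.
Qed.

Lemma Rintegral_markov (f : T -> R) (a : R) : integrable f ->
  (forall w, 0 <= f w) -> 0 < a ->
  (P [set w | (a < f w)%R] <= (\int[P]_w f w / a)%:E)%E.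
Proof.
move=> fi f0 a0.
have mf : measurable_fun [set: T] f by exact/measurable_EFinP/(measurable_int P).
have h := @le_integral_comp_abse _ _ _ P _ measurableT (EFin \o f) a id
  (@measurable_id _ _ _) (fun _ h => h) (fun _ _ _ _ h => h)
  ((measurable_EFinP _ _).2 mf) a0.
have mS : measurable [set w | a < f w].
  by rewrite -[X in measurable X]setTI; exact: measurable_fun_ltr.
rewrite EFinM lee_pdivlMr// muleC.
apply: le_trans (le_trans h _).
  rewrite lee_pmul2l// le_measure ?inE//.
  - rewrite setTI [X in measurable X](_ : _ = [set w | a <= f w]).
      by rewrite -[X in measurable X]setTI; exact: measurable_fun_ler.
    by apply/seteqP; split => w /=; rewrite lee_fin ger0_norm.
  - by move=> w /= /ltW afw; split => //=; rewrite lee_fin ger0_norm.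
rewrite /Rintegral fineK ?integrable_fin_num//.
by rewrite le_eqVlt; apply/orP; left; apply/eqP; apply: eq_integral => w _ /=;
  rewrite ger0_norm.
Qed.

Definition independent2 (U V : T -> R) := forall A B : set R,
  measurable A -> measurable B ->
  P (U @^-1` A `&` V @^-1` B) = (P (U @^-1` A) * P (V @^-1` B))%E.

(** Independence makes the law of the pair (U, V) agree with the product of the marginal laws on
    rectangles, hence everywhere; Fubini then factors the integral. *)
Lemma Rintegral_mul_independent (U V : T -> R) :
  measurable_fun [set: T] U -> measurable_fun [set: T] V ->
  independent2 U V -> integrable U -> integrable V ->
  integrable (fun w => U w * V w) ->
  \int[P]_w (U w * V w) = (\int[P]_w U w) * (\int[P]_w V w).
Proof.
move=> mU mV UV iU iV iUV.
pose U' : {mfun T >-> R} := mfun_Sub (mem_set mU).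
pose V' : {mfun T >-> R} := mfun_Sub (mem_set mV).
pose W : {mfun T >-> (R * R)%type} := mfun_Sub (mem_set (measurable_fun_pair mU mV)).
pose PU := distribution P U'; pose PV := distribution P V'.
pose f (z : (R * R)%type) : \bar R := (z.1 * z.2)%:E.
have mf : measurable_fun [set: (R * R)%type] f.
  by apply/measurable_EFinP; apply: measurable_funM.
have PW A : measurable A -> (PU \x PV)%E A = distribution P W A.
  move=> mA; apply: product_measure_unique mA => B C mB mC.
  by rewrite /distribution/= /pushforward/= -UV.
(* Fubini needs integrability under the product law, which is that of U V carried over by the change
   of variables. *)
have fi : (PU \x PV)%E.-integrable [set: (R * R)%type] f.
  apply/integrableP; split => //.
  rewrite (eq_measure_integral (distribution P W)); last by move=> A mA _; exact: PW.
  rewrite ge0_integral_distribution//; last exact: measurableT_comp.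
  by move/integrableP : iUV => [].
rewrite /Rintegral -(@integral_distribution _ _ _ _ _ P W f)//.
rewrite -(eq_measure_integral (distribution P W) (m1 := (PU \x PV)%E)); last first.
  by move=> A mA _; exact: PW.
rewrite -integral12_prod_meas1// /fubini_F/=.
have PVi : PV.-integrable [set: R] EFin.
  by apply: integrable_pushforward => //.
have EV : (\int[PV]_y y%:E = (\int[P]_w V w)%:E)%E.
  rewrite (@integral_distribution _ _ _ _ _ P V' EFin)//.
  by rewrite fineK// integrable_fin_num.
under eq_integral => x _.
  rewrite /f/=; under eq_integral do rewrite EFinM.
  rewrite integralZl// EV; over.
rewrite /= integralZr//; last by apply: integrable_pushforward.
by rewrite (@integral_distribution _ _ _ _ _ P U' EFin)// fineM// integrable_fin_num.
Qed.

(** Markov's inequality for the squared sum at level (n a)^2, whose expectation is at most n v. *)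
Lemma chebyshev_average (Y : nat -> T -> R) (v : R) :
  (forall i, measurable_fun [set: T] (Y i)) ->
  (forall i j, i != j -> independent2 (Y i) (Y j)) ->
  (forall i, integrable (fun w => Y i w ^+ 2)) ->
  (forall i, \int[P]_w Y i w = 0) ->
  (forall i, \int[P]_w (Y i w ^+ 2) <= v) ->
  forall (n : nat) (a : R), (0 < n)%N -> 0 < a ->
  (P [set w | (a < `|n%:R^-1 * \sum_(i < n) Y i w|)%R] <=
   (v / (n%:R * a ^+ 2))%:E)%E.
Proof.
move=> mY indY iY2 Y0 Yv n a n0 a0.
have n0' : 0 < n%:R :> R by rewrite ltr0n.
have iYY i j : integrable (fun w => Y i w * Y j w) by exact: integrable_mul_of_sqr.
have iY i : integrable (Y i) by exact: integrable_of_sqr.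
have sqrE w : (\sum_(i < n) Y i w) ^+ 2 = \sum_(i < n) \sum_(j < n) Y i w * Y j w.
  by rewrite expr2 mulr_suml; apply: eq_bigr => i _; rewrite mulr_sumr.
have iS : integrable (fun w => (\sum_(i < n) Y i w) ^+ 2).
  under eq_fun do rewrite sqrE.
  by apply: integrable_sum_real => i; exact: integrable_sum_real.
have ES : \int[P]_w ((\sum_(i < n) Y i w) ^+ 2) <= n%:R * v.
  under eq_Rintegral do rewrite sqrE.
  rewrite Rintegral_sum; last by move=> i; exact: integrable_sum_real.
  rewrite mulr_natl -[X in _ *+ X]card_ord -sumr_const; apply: ler_sum => i _.
  (* Pairwise independence and zero means remove the off-diagonal terms. *)
  rewrite Rintegral_sum// (bigD1 i)//= big1 ?addr0; last first.
    move=> j ji; rewrite Rintegral_mul_independent// ?Y0 ?mul0r//.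
    by apply: indY; rewrite eq_sym.
  exact: Yv.
have -> : [set w | a < `|n%:R^-1 * \sum_(i < n) Y i w|] =
    [set w | (n%:R * a) ^+ 2 < (\sum_(i < n) Y i w) ^+ 2].
  apply/seteqP; split => w /=.
  - rewrite normrM gtr0_norm ?invr_gt0// ltr_pdivlMl// => h.
    by rewrite -[ltRHS](real_normK (num_real _)) ltr_pXn2r ?nnegrE// mulr_ge0// ltW.
  - rewrite -[ltRHS](real_normK (num_real _)) ltr_pXn2r ?nnegrE// ?mulr_ge0 ?(ltW a0)//.
    by move=> h; rewrite normrM gtr0_norm ?invr_gt0// ltr_pdivlMl.
apply: le_trans (Rintegral_markov iS _ _) _.
- by move=> w; exact: sqr_ge0.
- by rewrite exprn_gt0// mulr_gt0.
rewrite lee_fin ler_pdivrMr ?exprn_gt0 ?mulr_gt0//.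
apply: le_trans ES _; rewrite le_eqVlt; apply/orP; left; apply/eqP.
by field; rewrite !gt_eqF.
Qed.

End probability_preliminaries.

(** * Continuous functions of an i.i.d. sample *)

Section iid_sample.
Context {R : realType} {d : measure_display} {T : measurableType d}.
Variables (P : probability T R) (X : nat -> T -> 'cV[R]_2).
Hypothesis X_iid : iid P X.

Local Notation integrable f := (P.-integrable [set: T] (EFin \o f)).

(** Viewing [borel2] as the measurable sets of a generated sigma-algebra reduces the claim to open
    intervals, whose preimages are open. *)
Lemma borel2_preimage (f : 'cV[R]_2 -> R) (A : set R) :
  continuous f -> measurable A -> borel2 (f @^-1` A).
Proof.
move=> cf mA.
have mf : measurable_fun [set: g_sigma_algebraType (@open 'cV[R]_2)] f.
  apply: (measurability (@RGenOpens.G R)); first exact: RGenOpens.measurableE.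
  move=> _ [_ [a [b ->]] <-]; rewrite setTI; apply: sub_sigma_algebra.
  by apply: open_comp => // v _; exact: cf.
by have := mf measurableT A mA; rewrite setTI.
Qed.

Lemma measurable_continuous_sample (f : 'cV[R]_2 -> R) (i : nat) :
  continuous f -> measurable_fun [set: T] (fun w => f (X i w)).
Proof.
move=> cf _ A mA; rewrite setTI.
by have [rX _ _] := X_iid; apply: (rX i (f @^-1` A)); exact: borel2_preimage.
Qed.

Lemma independent2_sample (f : 'cV[R]_2 -> R) (i j : nat) : continuous f ->
  i != j -> independent2 P (fun w => f (X i w)) (fun w => f (X j w)).
Proof.
move=> cf ij A B mA mB; have [_ indX _] := X_iid.
have := indX [:: i; j] (fun k => if k == i then f @^-1` A else f @^-1` B).
rewrite /= inE ij andbT => /(_ isT).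
rewrite !big_cons big_nil mule1 eqxx eq_sym (negbTE ij) => <-.
  congr (P _); apply/seteqP; split => [w [wA wB] k /=|w h].
    by rewrite !inE => /orP[]/eqP ->; rewrite ?eqxx// eq_sym (negbTE ij).
  split.
  - by have := h i; rewrite /= inE eqxx => /(_ isT).
  - by have := h j; rewrite /= !inE eqxx orbT eq_sym (negbTE ij) => /(_ isT).
by move=> k _; case: ifP => _; exact: borel2_preimage.
Qed.

(** Both integrals are means of the laws of f(X_i) and f(X_j), which coincide. *)
Lemma Rintegral_sample_eq (f : 'cV[R]_2 -> R) (i j : nat) : continuous f ->
  (forall k, integrable (fun w => f (X k w))) ->
  \int[P]_w f (X i w) = \int[P]_w f (X j w).
Proof.
move=> cf fi; have mf k := measurable_continuous_sample k cf.
pose U k : {mfun T >-> R} := mfun_Sub (mem_set (mf k)).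
have E k : (\int[P]_w (f (X k w))%:E = \int[distribution P (U k)]_y y%:E)%E.
  by rewrite (@integral_distribution _ _ _ _ _ P (U k) EFin)//; exact: fi.
rewrite /Rintegral !E; congr fine; apply: eq_measure_integral => A mA _.
have [_ _ idX] := X_iid.
by apply: (idX i j (f @^-1` A)); exact: borel2_preimage.
Qed.

Lemma chebyshev_sample (f : 'cV[R]_2 -> R) (v : R) : continuous f ->
  (forall i, integrable (fun w => f (X i w) ^+ 2)) ->
  \int[P]_w ((f (X 0 w) - \int[P]_u f (X 0 u)) ^+ 2) <= v ->
  forall (n : nat) (a : R), (0 < n)%N -> 0 < a ->
  (P [set w | (a < `|n%:R^-1 * \sum_(i < n) f (X i w) -
                    \int[P]_u f (X 0 u)|)%R] <= (v / (n%:R * a ^+ 2))%:E)%E.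
Proof.
move=> cf fi2 fv n a n0 a0.
have n0' : 0 < n%:R :> R by rewrite ltr0n.
have fi i : integrable (fun w => f (X i w)).
  by apply: integrable_of_sqr => //; exact: measurable_continuous_sample.
pose c := \int[P]_u f (X 0 u).
pose g x := f x - c.
have cg : continuous g.
  by move=> x; apply: (@continuousB R R^o _ f (cst c) x (cf x)); exact: cst_continuous.
have mg i := measurable_continuous_sample i cg.
have gi2 i : integrable (fun w => g (X i w) ^+ 2).
  (* From (f + c)^2 >= 0 follows (f - c)^2 <= 2 c^2 + 2 f^2. *)
  apply: (@le_integrable_real _ _ _ P _ (fun w => 2 * c ^+ 2 + (f (X i w) ^+ 2 + f (X i w) ^+ 2))).
  - exact: measurable_funX.
  - move=> w; rewrite ger0_norm ?sqr_ge0// /g.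
    by have := sqr_ge0 (f (X i w) + c); rewrite sqrrD sqrrB; lra.
  - apply: integrableD_real; first exact: integrable_cst_real.
    exact: integrableD_real.
have cg2 : continuous (fun x => g x ^+ 2).
  by move=> x; exact: (continuous_comp (cg x) (@exprn_continuous R 2 (g x))).
have := @chebyshev_average _ _ _ P (fun i w => g (X i w)) v mg _ gi2 _ _ n a n0 a0.
under [X in P X]eq_set => w.
  rewrite sumrB sumr_const card_ord -[X in _ - X]mulr_natl mulrBr mulKf ?gt_eqF//.
  over.
apply.
- by move=> i j ij; exact: (independent2_sample cg ij).
- move=> i; rewrite /g RintegralB//; last exact: integrable_cst_real.
  rewrite (Rintegral_sample_eq i 0 cf fi) Rintegral_cst//.
  by rewrite [X in fine X](_ : _ = 1%E) ?mulr1 ?subrr//; exact: probability_setT.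
- by move=> i; rewrite (Rintegral_sample_eq i 0 cg2 gi2).
Qed.

End iid_sample.

(** * The damped scatter matrix *)

Section moments.
Context {R : realType}.

Lemma continuous_sub_cst (mu : 'cV[R]_2) (f : 'cV[R]_2 -> R) :
  continuous f -> continuous (fun v : 'cV[R]_2 => f (v - mu)).
Proof.
move=> cf v; apply: (@continuous_comp _ _ _ (fun v : 'cV[R]_2 => v - mu) f); last exact: cf.
apply: (@continuousB R 'cV[R]_2 _ id (cst mu)); [exact: id|exact: cst_continuous].
Qed.

Lemma sqnorm_continuous : continuous (@sqnorm R).
Proof.
move=> v; rewrite /sqnorm; under eq_fun do rewrite big_ord_recl big_ord1.
apply: (@continuousD R R^o _ (fun v : 'cV[R]_2 => v ord0 0 ^+ 2)
   (fun v : 'cV[R]_2 => v (lift ord0 ord0) 0 ^+ 2)).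
- apply: (@continuous_comp _ _ _ (fun v : 'cV[R]_2 => v ord0 0) (fun x => x ^+ 2)).
    exact: coord_continuous.
  exact: exprn_continuous.
- apply: (@continuous_comp _ _ _ (fun v : 'cV[R]_2 => v (lift ord0 ord0) 0)
    (fun x => x ^+ 2)).
    exact: coord_continuous.
  exact: exprn_continuous.
Qed.

Lemma enorm_continuous : continuous (@enorm R).
Proof.
move=> v; apply: (@continuous_comp _ _ _ (@sqnorm R) Num.sqrt).
  exact: sqnorm_continuous.
exact: sqrt_continuous.
Qed.

Lemma damped_continuous (j k : 'I_2) : continuous (@damped R j k).
Proof.
move=> v; apply: (@continuousM R _ (fun v : 'cV[R]_2 => v j 0 * v k 0)
   (fun v => (1 + sqnorm v)^-1)).
  by apply: continuousM; exact: coord_continuous.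
apply: continuousV; first by rewrite gt_eqF// sqnorm1_gt0.
apply: (@continuousD R R^o _ (cst 1) (@sqnorm R)); first exact: cst_continuous.
exact: sqnorm_continuous.
Qed.

Context {d : measure_display} {T : measurableType d}.
Variables (P : probability T R) (Y : T -> 'cV[R]_2) (mu : 'cV[R]_2).
Hypothesis mY : forall f : 'cV[R]_2 -> R, continuous f ->
  measurable_fun [set: T] (fun w => f (Y w)).
Hypothesis Y_mean : has_mean P Y mu.
Hypothesis Y_mom3 : ('E_P[(fun w => enorm (Y w - mu) ^+ 3)%R] < +oo)%E.

Local Notation integrable f := (P.-integrable [set: T] (EFin \o f)).
Local Notation Z w := (Y w - mu).

Lemma measurable_centered (f : 'cV[R]_2 -> R) : continuous f ->
  measurable_fun [set: T] (fun w => f (Z w)).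
Proof. by move=> cf; exact: mY (fun v : 'cV[R]_2 => f (v - mu)) (continuous_sub_cst cf). Qed.

(** The third moment controls the second through t^2 <= 1 + t^3 for t >= 0. *)
Lemma integrable_sqnorm : integrable (fun w => sqnorm (Z w)).
Proof.
have i3 : integrable (fun w => enorm (Z w) ^+ 3).
  apply/integrableP; split.
    by apply/measurable_EFinP/measurable_funX; exact: (measurable_centered enorm_continuous).
  apply: le_lt_trans Y_mom3; rewrite unlock.
  rewrite le_eqVlt; apply/orP; left; apply/eqP; apply: eq_integral => w _ /=.
  by rewrite ger0_norm// exprn_ge0// sqrtr_ge0.
apply: (@le_integrable_real _ _ _ P _ (fun w => 1 + enorm (Z w) ^+ 3)).
- exact: (measurable_centered sqnorm_continuous).
- move=> w; rewrite ger0_norm ?sqnorm_ge0// -[leLHS](sqr_sqrtr (sqnorm_ge0 _)).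
  have : 0 <= enorm (Z w) by exact: sqrtr_ge0.
  rewrite -/(enorm (Z w)); move: (enorm _) => t t0.
  have : 0 <= (t - 1) ^+ 2 * (t + 1) by rewrite mulr_ge0 ?sqr_ge0// addr_ge0.
  have -> : (t - 1) ^+ 2 * (t + 1) = 1 + t ^+ 3 - t ^+ 2 - t by ring.
  lra.
- by apply: integrableD_real => //; exact: integrable_cst_real.
Qed.

Lemma measurable_coord (j : 'I_2) : measurable_fun [set: T] (fun w => Z w j 0).
Proof. by apply: (measurable_centered (f := fun v => v j 0)); exact: coord_continuous. Qed.

Lemma integrable_coord_sqr (j : 'I_2) : integrable (fun w => Z w j 0 ^+ 2).
Proof.
apply: le_integrable_real integrable_sqnorm.
  by apply: measurable_funX; exact: measurable_coord.
by move=> w; rewrite ger0_norm ?sqr_ge0// sqr_coord_le_sqnorm.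
Qed.

Lemma integrable_coord_mul (j k : 'I_2) : integrable (fun w => Z w j 0 * Z w k 0).
Proof.
by apply: integrable_mul_of_sqr;
  [exact: measurable_coord..|exact: integrable_coord_sqr|exact: integrable_coord_sqr].
Qed.

Lemma Rintegral_coord (j : 'I_2) : \int[P]_w Z w j 0 = 0.
Proof.
have iZ : integrable (fun w => Z w j 0).
  by apply: integrable_of_sqr; [exact: measurable_coord|exact: integrable_coord_sqr].
have -> : \int[P]_w Z w j 0 = \int[P]_w (Y w j 0) - mu j 0.
  apply/eqP; rewrite eq_sym subr_eq; apply/eqP.
  transitivity (\int[P]_w (Z w j 0 + mu j 0)).
    by apply: eq_Rintegral => w _; rewrite !mxE subrK.
  rewrite RintegralD//; last exact: integrable_cst_real.
  congr (_ + _); rewrite Rintegral_cst// [X in fine X](_ : _ = 1%E) ?mulr1//.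
  exact: probability_setT.
by have := Y_mean j; rewrite /Rintegral unlock => -> /=; rewrite subrr.
Qed.

Lemma covmxE (j k : 'I_2) : covmx P Y j k = \int[P]_w (Z w j 0 * Z w k 0).
Proof.
rewrite mxE unlock !Y_mean unlock /Rintegral; congr fine; apply: eq_integral => w _.
by rewrite /= !mxE.
Qed.

Lemma integrable_damped (j k : 'I_2) : integrable (fun w => damped j k (Z w)).
Proof.
apply: (le_integrable_real _ _ (integrable_cst_real P 1)).
  exact: (measurable_centered (@damped_continuous j k)).
by move=> w; exact: normr_damped_le1.
Qed.

Lemma normr_Rintegral_damped_le1 (j k : 'I_2) :
  `|\int[P]_w damped j k (Z w)| <= 1.
Proof.
apply: le_trans (le_normr_Rintegral measurableT (integrable_damped j k)) _.
have -> : 1 = \int[P]_w (1 : R).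
  by rewrite Rintegral_cst// mul1r [X in fine X](_ : _ = 1%E)//; exact: probability_setT.
apply: le_Rintegral => //; last by move=> w _; exact: normr_damped_le1.
  exact: (integrable_abse (integrable_damped j k)).
exact: integrable_cst_real.
Qed.

(** A nonnegative f with zero integral vanishes almost surely, and so does f g. With g = 1 + |Z|^2
    this undoes the damping. *)
Lemma Rintegral_mul_eq0 (f g : T -> R) : integrable f -> (forall w, 0 <= f w) ->
  measurable_fun [set: T] g -> \int[P]_w f w = 0 -> \int[P]_w (f w * g w) = 0.
Proof.
move=> fi f0 mg If; have mf := measurable_int P fi.
have f_ae0 : ae_eq P [set: T] (EFin \o f) (cst 0%E).
  apply/ae_eq_integral_abs => //.
  have I0 : (\int[P]_w (EFin \o f) w = 0)%E.
    by rewrite -(fineK (integrable_fin_num measurableT fi)); congr EFin.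
  by apply: etrans I0; apply: eq_integral => w _ /=; rewrite ger0_norm.
rewrite /Rintegral (ae_eq_integral (cst 0%E)) ?integral_cst ?mul0e//.
- by apply/measurable_EFinP/measurable_funM => //; exact/measurable_EFinP.
- by apply: filterS f_ae0 => w /= /[apply] -[->]; rewrite mul0r.
Qed.

(* If the form vanished at [v], [v . Z] would vanish almost surely, hence so
   would the quadratic form of the covariance matrix. *)
Lemma damped_form_gt0 (v0 v1 : R) : posdefmx (covmx P Y) ->
  (v0 != 0) || (v1 != 0) ->
  0 < v0 ^+ 2 * \int[P]_w damped 0 0 (Z w) +
      2 * v0 * v1 * \int[P]_w damped 0 1 (Z w) +
      v1 ^+ 2 * \int[P]_w damped 1 1 (Z w).
Proof.
move=> [_ pd] v_neq0.
pose f w := (v0 * Z w 0 0 + v1 * Z w 1 0) ^+ 2 / (1 + sqnorm (Z w)).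
have scale_int c h : integrable h -> integrable (fun w => c * h w).
  by move=> hi; exact: (integrableZl measurableT c hi).
have fE w : f w = v0 ^+ 2 * damped 0 0 (Z w) + 2 * v0 * v1 * damped 0 1 (Z w) +
    v1 ^+ 2 * damped 1 1 (Z w).
  by rewrite /f /damped; field; rewrite gt_eqF// sqnorm1_gt0.
have fi : integrable f.
  rewrite (funext fE).
  by apply: integrableD_real; [apply: integrableD_real|];
    apply: scale_int; exact: integrable_damped.
have If : \int[P]_w f w = v0 ^+ 2 * \int[P]_w damped 0 0 (Z w) +
      2 * v0 * v1 * \int[P]_w damped 0 1 (Z w) +
      v1 ^+ 2 * \int[P]_w damped 1 1 (Z w).
  under eq_Rintegral do rewrite fE.
  rewrite RintegralD//; [|apply: integrableD_real|];
    try by apply: scale_int; exact: integrable_damped.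
  rewrite RintegralD//; try by apply: scale_int; exact: integrable_damped.
  by rewrite !RintegralZl//; exact: integrable_damped.
have f0 w : 0 <= f w by rewrite divr_ge0 ?sqr_ge0// ltW// sqnorm1_gt0.
rewrite -If lt_neqAle Rintegral_ge0// andbT eq_sym; apply/negP => /eqP If0.
pose v : 'cV[R]_2 := \col_i (if i == 0 then v0 else v1).
have : 0 < (v^T *m covmx P Y *m v) 0 0.
  apply: pd; apply: contraTneq v_neq0 => v0E; rewrite negb_or !negbK.
  have := congr1 (fun M : 'cV[R]_2 => M 0 0) v0E.
  have := congr1 (fun M : 'cV[R]_2 => M 1 0) v0E.
  by rewrite !mxE/= => -> ->; rewrite eqxx.
suff -> : (v^T *m covmx P Y *m v) 0 0 = 0 by rewrite ltxx.
have m1 : measurable_fun [set: T] (fun w => 1 + sqnorm (Z w)).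
  by apply: measurable_funD => //; exact: (measurable_centered sqnorm_continuous).
(* The zero is rewritten as the integral of [f] times 1 + |Z|^2, that is of (v . Z)^2, which expands
   into the covariance form at [v]. *)
rewrite -(Rintegral_mul_eq0 fi f0 m1 If0).
have E w : f w * (1 + sqnorm (Z w)) = v0 ^+ 2 * (Z w 0 0 * Z w 0 0) +
    2 * v0 * v1 * (Z w 0 0 * Z w 1 0) + v1 ^+ 2 * (Z w 1 0 * Z w 1 0).
  by rewrite /f divfK ?gt_eqF ?sqnorm1_gt0//; ring.
under [RHS]eq_Rintegral do rewrite E.
rewrite RintegralD//; [|apply: integrableD_real|];
    try by apply: scale_int; exact: integrable_coord_mul.
rewrite RintegralD//; try by apply: scale_int; exact: integrable_coord_mul.
rewrite !RintegralZl//; try exact: integrable_coord_mul.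
rewrite -!covmxE.
have cE : covmx P Y 1 0 = covmx P Y 0 1.
  by rewrite !covmxE; apply: eq_Rintegral => w _; rewrite mulrC.
move: (covmx P Y) cE => S cE.
have l1 : lift ord0 ord0 = 1 :> 'I_2 by exact: val_inj.
rewrite !mxE !big_ord_recl !big_ord0 !mxE !big_ord_recl !big_ord0 !mxE !l1 /= cE.
by ring.
Qed.

(** The form at (1, 0) equals a, and at (-b, a) it equals a (a c - b^2); both are positive. *)
Lemma damped_det_gt0 : posdefmx (covmx P Y) ->
  0 < \int[P]_w damped 0 0 (Z w) * \int[P]_w damped 1 1 (Z w) -
      (\int[P]_w damped 0 1 (Z w)) ^+ 2.
Proof.
move=> pd; set a := \int[P]_w damped 0 0 _; set b := \int[P]_w damped 0 1 _.
set c := \int[P]_w damped 1 1 _.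
have a0 : 0 < a.
  have := @damped_form_gt0 1 0 pd; rewrite oner_eq0/= => /(_ isT).
  by rewrite -/a -/b -/c; congr (_ < _); ring.
have := @damped_form_gt0 (- b) a pd; rewrite (gt_eqF a0) orbT => /(_ isT).
rewrite -/a -/b -/c -(pmulr_rgt0 _ a0); congr (_ < _); ring.
Qed.

End moments.

(** * Probability of a good sample *)

Section rate.
Context {R : realType} {d : measure_display} {T : measurableType d}.
Variables (P : probability T R) (X : nat -> T -> 'cV[R]_2) (mu0 : 'cV[R]_2).
Hypothesis X_iid : iid P X.
Hypothesis X_mean : forall i, has_mean P (X i) mu0.
Hypothesis X_mom3 :
  forall i, ('E_P[(fun w => enorm (X i w - mu0) ^+ 3)%R] < +oo)%E.

Local Notation integrable f := (P.-integrable [set: T] (EFin \o f)).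

Let mX i (f : 'cV[R]_2 -> R) (cf : continuous f) :=
  measurable_continuous_sample X_iid i cf.

Definition average (f : 'cV[R]_2 -> R) (n : nat) (w : T) : R :=
  n%:R^-1 * \sum_(i < n) f (X i w - mu0).

Let measurable_average (f : 'cV[R]_2 -> R) (n : nat) : continuous f ->
  measurable_fun [set: T] (average f n).
Proof.
move=> cf; apply: measurable_funM => //; apply: measurable_sum => i.
exact: (measurable_centered mu0 (mX i) cf).
Qed.

Let measurable_gt (f : T -> R) (a : R) : measurable_fun [set: T] f ->
  measurable [set w | a < f w].
Proof.
by move=> mf; rewrite -[X in measurable X]setTI; exact: measurable_fun_ltr.
Qed.

(** The trace of the covariance matrix, which dominates the variance of each coordinate. *)
Definition moment := \int[P]_w sqnorm (X 0 w - mu0).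

Let moment_ge0 : 0 <= moment.
Proof. by apply: Rintegral_ge0 => w _; exact: sqnorm_ge0. Qed.

Let i_sqnorm i : integrable (fun w => sqnorm (X i w - mu0)).
Proof. exact: integrable_sqnorm (mX i) (X_mom3 i). Qed.

(** Chebyshev at a = K / sqrt(n), where n a^2 = K^2 makes the bound free of n. *)
Lemma average_coord_tail (j : 'I_2) (n : nat) (K : R) : (0 < n)%N -> 0 < K ->
  (P [set w | (K / Num.sqrt n%:R < `|average (fun v => v j 0) n w|)%R] <=
   (moment / K ^+ 2)%:E)%E.
Proof.
move=> n0 K0.
have n0' : 0 < n%:R :> R by rewrite ltr0n.
have sn0 : 0 < Num.sqrt n%:R :> R by rewrite sqrtr_gt0.
have cf : continuous (fun v : 'cV[R]_2 => (v - mu0) j 0).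
  by apply: (@continuous_sub_cst _ mu0 (fun v => v j 0)); exact: coord_continuous.
have m0 : \int[P]_w (X 0 w - mu0) j 0 = 0.
  exact: Rintegral_coord (mX 0) (X_mean 0) (X_mom3 0) j.
have := @chebyshev_sample _ _ _ P X X_iid _ moment cf _ _ n (K / Num.sqrt n%:R) n0.
rewrite m0 divr_gt0// => h.
have -> : moment / K ^+ 2 = moment / (n%:R * (K / Num.sqrt n%:R) ^+ 2).
  rewrite expr_div_n sqr_sqrtr ?ltW//; congr (_ / _).
  by rewrite mulrCA mulfV ?mulr1// gt_eqF.
rewrite /average.
under [X in P X]eq_set => w do rewrite -[X in `|X|]subr0.
apply: h => //.
- by move=> i; exact: integrable_coord_sqr (mX i) (X_mom3 i) j.
- apply: le_Rintegral => //.
  + by under eq_fun do rewrite subr0; exact: integrable_coord_sqr (mX 0) (X_mom3 0) j.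
  + by move=> w _; rewrite subr0 sqr_coord_le_sqnorm.
Qed.

(** A damped entry and its mean are both at most 1 in absolute value, so the variance is at most 2^2
    = 4. *)
Lemma average_damped_tail (j k : 'I_2) (n : nat) (e : R) : (0 < n)%N -> 0 < e ->
  (P [set w | (e < `|average (damped j k) n w -
                     \int[P]_u damped j k (X 0 u - mu0)|)%R] <=
   (4 / (n%:R * e ^+ 2))%:E)%E.
Proof.
move=> n0 e0.
have cf := @continuous_sub_cst _ mu0 _ (@damped_continuous R j k).
have mf i := measurable_centered mu0 (mX i) (@damped_continuous R j k).
apply: (@chebyshev_sample _ _ _ P X X_iid _ 4 cf) => // [i|].
  apply: le_integrable_real (integrable_cst_real P 1).
    exact: measurable_funX.
  move=> w; rewrite normrX expr_le1//; exact: normr_damped_le1.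
pose c := \int[P]_u damped j k (X 0 u - mu0); rewrite -/c.
have c1 : `|c| <= 1 by apply: normr_Rintegral_damped_le1; exact: (mX 0).
have le4 w : (damped j k (X 0 w - mu0) - c) ^+ 2 <= 4.
  rewrite -(real_normK (num_real _)) (_ : 4 = 2 ^+ 2); last by ring.
  rewrite ler_sqr ?nnegrE// (le_trans (ler_normB _ _))//.
  by have := normr_damped_le1 j k (X 0 w - mu0); move: c1; lra.
have -> : 4 = \int[P]_w (4 : R).
  by rewrite Rintegral_cst// [X in fine X](_ : _ = 1%E) ?mulr1//; exact: probability_setT.
apply: le_Rintegral => //; last exact: integrable_cst_real.
apply: le_integrable_real (integrable_cst_real P 4).
  by apply: measurable_funX; exact: measurable_funB.
by move=> w; rewrite ger0_norm ?sqr_ge0.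
Qed.

(** Only boundedness in probability is sought here, so Markov's inequality for the average itself
    suffices. *)
Lemma average_sqnorm_tail (n : nat) (K : R) : (0 < n)%N -> 0 < K ->
  (P [set w | (K ^+ 2 < average (@sqnorm R) n w)%R] <= (moment / K ^+ 2)%:E)%E.
Proof.
move=> n0 K0.
have n0' : 0 < n%:R :> R by rewrite ltr0n.
have iS : integrable (fun w => \sum_(i < n) sqnorm (X i w - mu0)).
  exact: integrable_sum_real.
have -> : moment = \int[P]_w average (@sqnorm R) n w.
  rewrite /average RintegralZl// Rintegral_sum//.
  rewrite (eq_bigr (fun=> moment)); last first.
    move=> i _; apply: (@Rintegral_sample_eq _ _ _ P X X_iid
      (fun v => sqnorm (v - mu0))) => //.
    by apply: continuous_sub_cst; exact: sqnorm_continuous.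
  by rewrite sumr_const card_ord -[moment *+ n]mulr_natl mulKf// gt_eqF.
apply: Rintegral_markov; last by rewrite exprn_gt0.
- exact: (integrableZl measurableT _ iS).
- move=> w; apply: mulr_ge0; first by rewrite invr_ge0 ltW.
  by apply: sumr_ge0 => i _; exact: sqnorm_ge0.
Qed.

(** Six bad events of probability at most eps / 6 each are discarded; on the remaining samples
    [argmax_EL_dist] applies with c1 = c2 = K. *)
Lemma argmax_EL_rate (A : set 'cV[R]_2) (muhat : nat -> T -> 'cV[R]_2) :
  posdefmx (covmx P (X 0)) -> A mu0 -> EL_selection X A mu0 muhat ->
  bigO_prob P (fun n w => muhat n w - mu0) (fun n => (Num.sqrt n%:R)^-1).
Proof.
move=> pd Amu0 sel eps eps0.
pose S j k := \int[P]_w damped j k (X 0 w - mu0).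
pose D := S 0 0 * S 1 1 - S 0 1 ^+ 2.
have D0 : 0 < D := damped_det_gt0 (mX 0) (X_mean 0) (X_mom3 0) pd.
(* These are the tolerance and the resulting determinant bound of [det2_perturb]. *)
pose e := D / 8; pose delta := D / 2.
have e0 : 0 < e by rewrite divr_gt0.
have delta0 : 0 < delta by rewrite divr_gt0.
(* The summand 1 gives K^2 >= K, so that K^2 >= 6 moment / eps. *)
pose K := 1 + 6 * moment / eps.
have K1 : 1 <= K by rewrite lerDl divr_ge0 ?mulr_ge0// ltW.
have K0 : 0 < K by exact: lt_le_trans K1.
have momentK : moment / K ^+ 2 <= eps / 6.
  rewrite ler_pdivrMr ?exprn_gt0//.
  apply: (@le_trans _ _ (eps / 6 * K)).
    rewrite /K mulrDr mulr1 (_ : eps / 6 * (6 * moment / eps) = moment).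
      by rewrite lerDr divr_ge0// ltW.
    by field; rewrite gt_eqF.
  by rewrite ler_pM2l ?divr_gt0// expr2 ler_peMl// ltW.
exists (2 * (K + (2 * (2 * (4 * K / delta) ^+ 2 + 1) + 1) * K)).
near=> n.
have n0 : (0 < n)%N by near: n; exact: nbhs_infty_gt.
have n0' : 0 < n%:R :> R by rewrite ltr0n.
have sn0 : 0 < Num.sqrt n%:R :> R by rewrite sqrtr_gt0.
(* The first threshold brings the tail of a damped entry below eps / 6; the second makes the tilt at
   most 1/2. *)
have n1 : 24 / (eps * e ^+ 2) <= n%:R by near: n; exact: nbhs_infty_ger.
have n2 : (8 * K / delta) ^+ 2 <= n%:R by near: n; exact: nbhs_infty_ger.
have dampedK : 4 / (n%:R * e ^+ 2) <= eps / 6.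
  rewrite ler_pdivrMr ?mulr_gt0 ?exprn_gt0//.
  move: n1; rewrite ler_pdivrMr ?mulr_gt0 ?exprn_gt0//.
  by rewrite mulrCA; set t := n%:R * _; lra.
have tau : 4 * (K / Num.sqrt n%:R) / delta <= 2^-1.
  have : 8 * K / delta <= Num.sqrt n%:R.
    have t0 : 0 <= 8 * K / delta by rewrite divr_ge0 ?mulr_ge0// ltW.
    by rewrite -[leLHS](ger0_norm t0) -sqrtr_sqr ler_wsqrtr.
  rewrite !ler_pdivrMr// !mulrA ler_pdivrMr//; lra.
pose small (E : set T) (a : R) := measurable E /\ (P E <= a%:E)%E.
have smallU E F a b : small E a -> small F b -> small (E `|` F) (a + b).
  move=> [mE PE] [mF PF]; split; first exact: measurableU.
  by apply: le_trans (measureU2 _ mE mF) _; rewrite EFinD leeD.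
have small_coord j :
    small [set w | K / Num.sqrt n%:R < `|average (fun v => v j 0) n w|] (eps / 6).
  split.
    apply/measurable_gt/measurableT_comp => //.
    by apply: measurable_average; exact: coord_continuous.
  by apply: le_trans (average_coord_tail j n0 K0) _; rewrite lee_fin.
have small_sqnorm : small [set w | K ^+ 2 < average (@sqnorm R) n w] (eps / 6).
  split; first by apply/measurable_gt/measurable_average; exact: sqnorm_continuous.
  by apply: le_trans (average_sqnorm_tail n0 K0) _; rewrite lee_fin.
have small_damped j k :
    small [set w | e < `|average (damped j k) n w - S j k|] (eps / 6).
  split.
    apply/measurable_gt/measurableT_comp => //; apply: measurable_funB => //.
    by apply: measurable_average; exact: damped_continuous.
  by apply: le_trans (average_damped_tail j k n0 e0) _; rewrite lee_fin.
(* Two coordinates, the second moment and three entries of the symmetric scatter matrix make up the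
   six events. *)
have := smallU _ _ _ _ (smallU _ _ _ _ (smallU _ _ _ _ (small_coord 0) (small_coord 1))
  small_sqnorm) (smallU _ _ _ _ (smallU _ _ _ _ (small_damped 0 0) (small_damped 0 1))
  (small_damped 1 1)).
set B := (X in small X _) => -[mB PB].
apply: (@le_trans _ _ (P B)); last first.
  by apply: le_trans PB _; rewrite lee_fin; lra.
(* The deviation event of [muhat] may fail to be measurable; its outer measure is bounded by
   covering it with the measurable set [B]. *)
rewrite -(measurable_mu_extE P mB); apply: le_mu_ext => w /= bad.
apply: contrapT => good; move: bad; apply/negP; rewrite -leNgt invrK.
have coord_good j : `|average (fun v => v j 0) n w| <= K / Num.sqrt n%:R.
  rewrite leNgt; apply/negP => h; apply: good; left; left.
  have [jE|jE] : j = 0 \/ j = 1.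
  - by case: j {h} => [[|[|//]] ?]; [left|right]; exact: val_inj.
  - by left; rewrite /= -jE.
  - by right; rewrite /= -jE.
have sqnorm_good : average (@sqnorm R) n w <= K ^+ 2.
  by rewrite leNgt; apply/negP => h; apply: good; left; right.
have good00 : `|average (damped 0 0) n w - S 0 0| <= e.
  by rewrite leNgt; apply/negP => h; apply: good; right; left; left.
have good01 : `|average (damped 0 1) n w - S 0 1| <= e.
  by rewrite leNgt; apply/negP => h; apply: good; right; left; right.
have good11 : `|average (damped 1 1) n w - S 1 1| <= e.
  by rewrite leNgt; apply/negP => h; apply: good; right; right.
have average_le1 j k : `|average (damped j k) n w| <= 1.
  by apply: normr_average_le1 => // i; exact: normr_damped_le1.
have S_le1 j k : `|S j k| <= 1 by apply: normr_Rintegral_damped_le1; exact: (mX 0).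
have det_ge := det2_perturb (average_le1 0 0) (average_le1 0 1) (average_le1 1 1)
  (S_le1 0 0) (S_le1 0 1) (S_le1 1 1) good00 good01 good11.
apply: (@argmax_EL_dist R n (sample X n w) A mu0 (muhat n w) K K delta) => //.
by have [sel1 _] := sel n w n0; exact: sel1.
Unshelve. all: by end_near.
Qed.

End rate.

Theorem lemma2p4 (R : realType) (d : measure_display) (T : measurableType d)
    (P : probability T R) (X : nat -> T -> 'cV[R]_2)
    (m : R) (mu0 : 'cV[R]_2)
    (muhatTheta muhatH : nat -> T -> 'cV[R]_2)
    (mu0E : mu0 = const_mx m)
    (X_iid : iid P X)
    (X_mean : forall i, has_mean P (X i) mu0)
    (X_var : forall i, posdefmx (covmx P (X i)))
    (X_mom3 : forall i, ('E_P[(fun w => enorm (X i w - mu0) ^+ 3)%R] < +oo)%E)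
    (X_hull : forall M : R,
       (fun n : nat =>
          P [set w | [set mu0 + (Num.sqrt n%:R)^-1 *: h |
                       h in [set h : 'cV[R]_2 | enorm h <= M]]
                     `<=` interior (conv_hull (sample X n w))])
         @ \oo --> (1%:E : \bar R))
    (selTheta : EL_selection X (@Theta R) mu0 muhatTheta)
    (selH : EL_selection X (@Hline R) mu0 muhatH) :
  bigO_prob P (fun n w => muhatTheta n w - mu0) (fun n => (Num.sqrt n%:R)^-1) /\
  bigO_prob P (fun n w => muhatH n w - mu0) (fun n => (Num.sqrt n%:R)^-1).
Proof.
(* Since - m + m = 0, mu0 lies on the line and thus in both constraint sets, as [argmax_EL_rate]
   requires. *)
have ortho : ((avec R)^T *m mu0) 0 0 = 0.
  by rewrite mu0E !mxE big_ord_recl big_ord1 !mxE/= mulN1r mul1r addNr.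
split.
- apply: (argmax_EL_rate X_iid X_mean X_mom3 (X_var 0) _ selTheta).
  by rewrite /Theta /= ortho.
- exact: (argmax_EL_rate X_iid X_mean X_mom3 (X_var 0) ortho selH).
Qed.
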